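(* Let $(R,A,\phi,\{a_{i,j,l}\}_{i,j,l\in I})$ be an admissible datum over $\mathbb F$, and let $\widehat{\mathcal C}$ be the associated category, with the bifunctor $\widehat\otimes$ on objects and morphisms, the morphisms $a_{\mathbf m,\mathbf s,\mathbf t}:(\mathbf m\widehat\otimes\mathbf s)\widehat\otimes\mathbf t\to\mathbf m\widehat\otimes(\mathbf s\widehat\otimes\mathbf t)$, and the identity morphisms $l_{\mathbf m}:\mathbf e_1\widehat\otimes\mathbf m\to\mathbf m$, $r_{\mathbf m}:\mathbf m\widehat\otimes\mathbf e_1\to\mathbf m$ (all as defined in the context). Then $\widehat{\mathcal C}$, with tensor product $\widehat\otimes$, unit object $\mathbf e_1$, associativity constraint $a$ and unit constraints $l,r$, is a tensor category over $\mathbb F$.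
   Context: **Matrices.** $\mathbb F$ is an algebraically closed field, $\mathbb N=\{0,1,2,\dots\}$, $I=\{1,\dots,n\}$. Let $A$ be an $\mathbb F$-algebra with orthogonal idempotents $e_1,\dots,e_n$ summing to $1$. For $\mathbf m=(m_1,\dots,m_n)\in\mathbb N^I$ put $|\mathbf m|=\sum_i m_i$; $\mathbf 0=(0,\dots,0)$ and $\mathbf e_i\in\mathbb N^I$ is the $i$-th standard vector. For nonzero $\mathbf m,\mathbf s$, an $(\mathbf m,\mathbf s)$-type matrix over $A$ is a $|\mathbf m|\times|\mathbf s|$ block matrix $X=(X_{ij})_{i,j\in I}$ with $X_{ij}\in M_{m_i\times s_j}(e_iAe_j)$ (block rows with $m_i=0$ and block columns with $s_j=0$ are absent). If $\mathbf m=\mathbf 0$ or $\mathbf s=\mathbf 0$, the only $(\mathbf m,\mathbf s)$-type matrix is the zero matrix of size $\max(1,|\mathbf m|)\times\max(1,|\mathbf s|)$. $M_{\mathbf m\times\mathbf s}(A)$ is the $\mathbb F$-space of $(\mathbf m,\mathbf s)$-type matrices; $M_{\mathbf m}(A)=M_{\mathbf m\times\mathbf m}(A)$ is an algebra under matrix multiplication with unity $E_{\mathbf m}$, the block diagonal matrix whose $i$-th diagonal block is $e_i$ times the identity matrix of size $m_i$; $E_{\mathbf 0}=0$. A $1\times1$ matrix is identified with its entry, so $M_{\mathbf e_i\times\mathbf e_j}(A)=e_iAe_j$. **Annihilators.** An $(\mathbf m,\mathbf s)$-type matrix $X$ is column-independent if for every $\mathbf l$ and every $(\mathbf s,\mathbf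 l)$-type $Y$, $XY=0$ implies $Y=0$; it is row-independent if for every $\mathbf l$ and every $(\mathbf l,\mathbf m)$-type $Y$, $YX=0$ implies $Y=0$. An $(\mathbf s,\mathbf t)$-type $Y$ is a right universal annihilator of $X$ if $XY=0$ and for every $(\mathbf s,\mathbf l)$-type $M$ with $XM=0$ there is a unique $(\mathbf t,\mathbf l)$-type $Z$ with $M=YZ$. A $(\mathbf t,\mathbf m)$-type $Y$ is a left universal annihilator of $X$ if $YX=0$ and for every $(\mathbf l,\mathbf m)$-type $M$ with $MX=0$ there is a unique $(\mathbf l,\mathbf t)$-type $Z$ with $M=ZY$. **Admissible algebra.** A finite dimensional $\mathbb F$-algebra $A$ with a complete set of orthogonal primitive idempotents $\{e_i\}_{i\in I}$ is called admissible if: (KS) $e_iAe_jAe_i\subseteq\mathrm{rad}(e_iAe_i)$ for all $i\ne j$; (Dec) every $(\mathbf m,\mathbf s)$-type matrix is a product $X_1X_2$ of a column-independent $(\mathbf m,\mathbf t)$-type matrix $X_1$ and a row-independent $(\mathbf t,\mathbf s)$-type matrix $X_2$; (RUA) every $(\mathbf m,\mathbf s)$-type matrix has a right universal annihilator; (LUA) every $(\mathbf m,\mathbf s)$-type matrix has a left universal annihilator; (CI) if $X$ is column-independent and $Y$ is a left universal annihilator of $X$, then $X$ is a right universal annihilator of $Y$; (RI) if $X$ is row-independent and $Y$ is a right universal annihilator of $X$, then $X$ is a left universal annihilator of $Y$. **Ring and algebra map.** $R$ is a $\mathbb Z_+$-ring with finite unital $\mathbb Z_+$-basis $\{r_i\}_{i\in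 I}$, i.e. a ring free over $\mathbb Z$ with basis $\{r_i\}$, $r_1=1$, $r_ir_j=\sum_k c_{ijk}r_k$ with $c_{ijk}\in\mathbb N$; assume $r_ir_j\neq0$ for all $i,j$. Put $\mathbf c_{ij}=(c_{ij1},\dots,c_{ijn})\in\mathbb N^I$. Let $M(R,A,I)=\bigoplus_{i,i',j,j'\in I}M_{\mathbf c_{i'j'}\times\mathbf c_{ij}}(A)$, an algebra in which the product of $X$ in the summand $M_{\mathbf c_{i'j'}\times\mathbf c_{ij}}(A)$ and $Y$ in the summand $M_{\mathbf c_{i''j''}\times\mathbf c_{i_1j_1}}(A)$ is the matrix product if $(i,j)=(i'',j'')$ and $0$ otherwise. $\phi:A\otimes_{\mathbb F}A\to M(R,A,I)$ is an $\mathbb F$-algebra map with ($\phi$1) $\phi(e_i\otimes e_j)=E_{\mathbf c_{ij}}\in M_{\mathbf c_{ij}}(A)$ and ($\phi$2) $\phi(e_1\otimes a)=a\in M_{\mathbf c_{1i}\times\mathbf c_{1j}}(A)$, $\phi(a\otimes e_1)=a\in M_{\mathbf c_{i1}\times\mathbf c_{j1}}(A)$ for $a\in e_iAe_j$ (note $\mathbf c_{1i}=\mathbf c_{i1}=\mathbf e_i$). Hence $\phi$ maps $e_{i'}Ae_i\otimes e_{j'}Ae_j$ into $M_{\mathbf c_{i'j'}\times\mathbf c_{ij}}(A)$. **The product $\widehat\otimes$.** $\mathbf m\widehat\otimes\mathbf s=\sum_{i,j}m_is_j\mathbf c_{ij}$; this is associative on $\mathbb N^I$ with unit $\mathbf e_1$.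 Let $X=(x_{pp'})\in M_{\mathbf s_1\times\mathbf m_1}(A)$, $Y=(y_{qq'})\in M_{\mathbf s_2\times\mathbf m_2}(A)$. If $\mathbf m_1\widehat\otimes\mathbf m_2=\mathbf 0$ or $\mathbf s_1\widehat\otimes\mathbf s_2=\mathbf 0$, $X\widehat\otimes Y$ is the zero element of $M_{(\mathbf s_1\widehat\otimes\mathbf s_2)\times(\mathbf m_1\widehat\otimes\mathbf m_2)}(A)$. Otherwise, let $X\otimes_{\mathbb F}Y$ be the $|\mathbf s_1||\mathbf s_2|\times|\mathbf m_1||\mathbf m_2|$ matrix over $A\otimes A$ whose entry in row $(q-1)|\mathbf s_1|+p$ and column $(q'-1)|\mathbf m_1|+p'$ is $x_{pp'}\otimes y_{qq'}$. Apply $\phi$ to every entry, getting a matrix of blocks $(Z_{lk})$ with $Z_{lk}\in M_{\mathbf h_l\times\mathbf t_k}(A)$ for suitable $\mathbf h_l,\mathbf t_k$ among the $\mathbf c_{ij}$ (an entry in $e_{i'}Ae_i\otimes e_{j'}Ae_j$ gives a block of type $(\mathbf c_{i'j'},\mathbf c_{ij})$). Then $X\widehat\otimes Y=\Pi(\phi(X\otimes_{\mathbb F}Y))\in M_{(\mathbf s_1\widehat\otimes\mathbf s_2)\times(\mathbf m_1\widehat\otimes\mathbf m_2)}(A)$, where $\Pi$ permutes rows so that first come all rows of idempotent type $1$ (from block row $l=1$, then $l=2$, ..., keeping the order inside each block), then all rows of type $2$, etc., and permutes columns in the same way. **Elementary matrices.** For $m_i>0$, $1\le k\le m_i$, $Y^{\mathbf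 m}_{i,k}\in M_{\mathbf e_i\times\mathbf m}(A)$ is the row with $e_i$ in position $k+\sum_{l<i}m_l$ and $0$ elsewhere, and $X^{\mathbf m}_{i,k}\in M_{\mathbf m\times\mathbf e_i}(A)$ is its transpose. **Associator system.** A family $a_{i,j,l}\in M_{\mathbf e_i\widehat\otimes\mathbf e_j\widehat\otimes\mathbf e_l}(A)$ ($i,j,l\in I$) satisfies (Ass) if: (1) each $a_{i,j,l}$ is invertible in $M_{\mathbf e_i\widehat\otimes\mathbf e_j\widehat\otimes\mathbf e_l}(A)$; (2) $(x\widehat\otimes(y\widehat\otimes z))a_{i,j,l}=a_{i',j',l'}((x\widehat\otimes y)\widehat\otimes z)$ for all $x\in e_{i'}Ae_i$, $y\in e_{j'}Ae_j$, $z\in e_{l'}Ae_l$; (3) $a_{i,1,j}=E_{\mathbf c_{ij}}$; (4) for all $i_1,i_2,i_3,i_4\in I$, $$\sum_{j=1}^n\sum_{1\le k\le c_{i_2i_3j}}\bigl(e_{i_1}\widehat\otimes a_{i_2,i_3,i_4}(X^{\mathbf c_{i_2i_3}}_{j,k}\widehat\otimes e_{i_4})\bigr)a_{i_1,j,i_4}\bigl((e_{i_1}\widehat\otimes Y^{\mathbf c_{i_2i_3}}_{j,k})a_{i_1,i_2,i_3}\widehat\otimes e_{i_4}\bigr)$$ $$=\sum_{j,j'=1}^n\sum_{1\le k\le c_{i_3i_4j}}\sum_{1\le k'\le c_{i_1i_2j'}}\bigl(e_{i_1}\widehat\otimes(e_{i_2}\widehat\otimes X^{\mathbf c_{i_3i_4}}_{j,k})\bigr)a_{i_1,i_2,j}\bigl(X^{\mathbf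 c_{i_1i_2}}_{j',k'}\widehat\otimes Y^{\mathbf c_{i_3i_4}}_{j,k}\bigr)a_{j',i_3,i_4}\bigl((Y^{\mathbf c_{i_1i_2}}_{j',k'}\widehat\otimes e_{i_3})\widehat\otimes e_{i_4}\bigr).$$ For $\mathbf m,\mathbf s,\mathbf t\in\mathbb N^I$ put $a_{\mathbf m,\mathbf s,\mathbf t}=0=E_{\mathbf 0}$ if $\mathbf m\widehat\otimes\mathbf s\widehat\otimes\mathbf t=\mathbf 0$, and otherwise $$a_{\mathbf m,\mathbf s,\mathbf t}=\sum_{i,j,l:\,m_is_jt_l>0}\sum_{k_1=1}^{m_i}\sum_{k_2=1}^{s_j}\sum_{k_3=1}^{t_l}\bigl(X^{\mathbf m}_{i,k_1}\widehat\otimes(X^{\mathbf s}_{j,k_2}\widehat\otimes X^{\mathbf t}_{l,k_3})\bigr)a_{i,j,l}\bigl((Y^{\mathbf m}_{i,k_1}\widehat\otimes Y^{\mathbf s}_{j,k_2})\widehat\otimes Y^{\mathbf t}_{l,k_3}\bigr).$$ **Admissible datum.** $(R,A,\phi,\{a_{i,j,l}\})$ is an admissible datum if $R$ is a $\mathbb Z_+$-ring with finite unital $\mathbb Z_+$-basis $\{r_i\}_{i\in I}$ such that $r_1=1$ and $r_ir_j\neq0$ for all $i,j\in I$, $A$ is an admissible algebra with $\dim_{\mathbb F}(e_1Ae_1)=1$, $\phi:A\otimes_{\mathbb F}A\to M(R,A,I)$ is an $\mathbb F$-algebra map satisfying ($\phi$1) and ($\phi$2), and $\{a_{i,j,l}\}$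 satisfies (Ass). **The category $\widehat{\mathcal C}$.** Objects: $\mathbb N^I$; $\mathrm{Hom}_{\widehat{\mathcal C}}(\mathbf m,\mathbf s)=M_{\mathbf s\times\mathbf m}(A)$; composition is matrix multiplication; $\mathrm{id}_{\mathbf m}=E_{\mathbf m}$. The morphisms $l_{\mathbf m}$, $r_{\mathbf m}$ are $E_{\mathbf m}$. ''Tensor category over $\mathbb F$'' means $\mathbb F$-linear monoidal category with $\mathbb F$-bilinear tensor product. *)

(* Defs.v *)
From HB Require Import structures.
From mathcomp Require Import all_boot all_order all_algebra falgebra.
From mathcomp Require Import mxtens.

Set Implicit Arguments.
Unset Strict Implicit.
Unset Printing Implicit Defensive.

Import GRing.Theory.
Local Open Scope ring_scope.

(* The index set I = {1, ..., n} is 'I_n.+1, nonempty because it contains the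
   index of the unit of R; the index 1 is ord0. *)
Notation nvec n := {ffun 'I_n.+1 -> nat}.
Notation "`| m |_1" := (\sum_i m i)%N (at level 0, format "`| m |_1").

Definition evec n (i : 'I_n.+1) : nvec n := [ffun j => (i == j) : nat].

(* F-linear monoidal categories *)

Record monoidal_data (F : fieldType) := MonoidalData {
  obj :> Type;
  hom : obj -> obj -> lmodType F;
  idm : forall x, hom x x;
  comp : forall x y z, hom y z -> hom x y -> hom x z;
  tobj : obj -> obj -> obj;
  thom : forall x y x' y', hom x y -> hom x' y' -> hom (tobj x x') (tobj y y');
  munit : obj;
  assoc : forall x y z, hom (tobj (tobj x y) z) (tobj x (tobj y z));
  lunit : forall x, hom (tobj munit x) x;
  runit : forall x, hom (tobj x munit) x }.

Arguments idm {F C} x : rename.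
Arguments comp {F C x y z} g f : rename.
Arguments tobj {F C} x y : rename.
Arguments thom {F C x y x' y'} f g : rename.
Arguments munit {F} C : rename.
Arguments assoc {F C} x y z : rename.
Arguments lunit {F C} x : rename.
Arguments runit {F C} x : rename.

Definition isom (F : fieldType) (C : monoidal_data F) (x y : C)
    (f : hom x y) : Prop :=
  exists g : hom y x, comp g f = idm x /\ comp f g = idm y.

Record tensor_category (F : fieldType) (C : monoidal_data F) : Prop := {
  comp_assoc : forall (x y z w : C) (h : hom z w) (g : hom y z) (f : hom x y),
    comp h (comp g f) = comp (comp h g) f;
  comp_idl : forall (x y : C) (f : hom x y), comp (idm y) f = f;
  comp_idr : forall (x y : C) (f : hom x y), comp f (idm x) = f;
  comp_linear_l : forall (x y z : C) (f : hom x y) a (g g' : hom y z),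
    comp (a *: g + g') f = a *: comp g f + comp g' f;
  comp_linear_r : forall (x y z : C) (g : hom y z) a (f f' : hom x y),
    comp g (a *: f + f') = a *: comp g f + comp g f';
  thom_id : forall x y : C, thom (idm x) (idm y) = idm (tobj x y);
  thom_comp : forall (x y z x' y' z' : C) (g : hom y z) (f : hom x y)
      (g' : hom y' z') (f' : hom x' y'),
    thom (comp g f) (comp g' f') = comp (thom g g') (thom f f');
  thom_linear_l : forall (x y x' y' : C) (g : hom x' y') a (f f' : hom x y),
    thom (a *: f + f') g = a *: thom f g + thom f' g;
  thom_linear_r : forall (x y x' y' : C) (f : hom x y) a (g g' : hom x' y'),
    thom f (a *: g + g') = a *: thom f g + thom f g';
  assoc_natural : forall (x y z x' y' z' : C)
      (f : hom x x') (g : hom y y') (h : hom z z'),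
    comp (thom f (thom g h)) (assoc x y z)
      = comp (assoc x' y' z') (thom (thom f g) h);
  assoc_isom : forall x y z : C, isom (assoc x y z);
  lunit_natural : forall (x y : C) (f : hom x y),
    comp f (lunit x) = comp (lunit y) (thom (idm (munit C)) f);
  lunit_isom : forall x : C, isom (lunit x);
  runit_natural : forall (x y : C) (f : hom x y),
    comp f (runit x) = comp (runit y) (thom f (idm (munit C)));
  runit_isom : forall x : C, isom (runit x);
  pentagon : forall x y z w : C,
    comp (thom (idm x) (assoc y z w))
         (comp (assoc x (tobj y z) w) (thom (assoc x y z) (idm w)))
      = comp (assoc x y (tobj z w)) (assoc (tobj x y) z w);
  triangle : forall x y : C,
    comp (thom (idm x) (lunit y)) (assoc x (munit C) y)
      = thom (runit x) (idm y) }.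

(* Z_+-rings *)

Record zplus_basis (R : pzRingType) (n : nat) := ZplusBasis {
  zr :> 'I_n.+1 -> R;
  zc : 'I_n.+1 -> 'I_n.+1 -> nvec n;
  zr_basis : forall x : R,
    exists! z : {ffun 'I_n.+1 -> int}, x = \sum_i zr i *~ z i;
  zr1 : zr ord0 = 1;
  zrM : forall i j, zr i * zr j = \sum_k zr k *+ zc i j k }.

Definition otens R n (r : zplus_basis R n) (m s : nvec n) : nvec n :=
  [ffun k => \sum_i \sum_j m i * s j * zc r i j k]%N.

Section ZplusTheory.
Context (R : pzRingType) (n : nat) (r : zplus_basis R n).

Lemma zr_coef_inj (z z' : nvec n) :
  \sum_i r i *+ z i = \sum_i r i *+ z' i -> z = z'.
Proof.
move=> eqz; pose toZ (z : nvec n) : {ffun 'I_n.+1 -> int} := [ffun i => (z i)%:Z].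
have [w [_ uw]] := zr_basis r (\sum_i r i *+ z i).
have hz : w = toZ z.
  by apply: uw; apply: eq_bigr => i _; rewrite ffunE pmulrn.
have hz' : w = toZ z'.
  by apply: uw; rewrite eqz; apply: eq_bigr => i _; rewrite ffunE pmulrn.
apply/ffunP => i; move: hz'; rewrite hz => /ffunP/(_ i).
by rewrite !ffunE => -[].
Qed.

Lemma zr_evec i : r i = \sum_k r k *+ evec i k.
Proof.
rewrite (bigD1 i) //= ffunE eqxx big1 ?addr0 // => j /negbTE ji.
by rewrite ffunE eq_sym ji.
Qed.

Lemma zc1l i : zc r ord0 i = evec i.
Proof. by apply: zr_coef_inj; rewrite -zrM zr1 mul1r -zr_evec. Qed.

Lemma zc1r i : zc r i ord0 = evec i.
Proof. by apply: zr_coef_inj; rewrite -zrM zr1 mulr1 -zr_evec. Qed.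

Lemma sum_evecl i (f : 'I_n.+1 -> nat) : (\sum_j evec i j * f j = f i)%N.
Proof.
rewrite (bigD1 i) //= ffunE eqxx mul1n big1 ?addn0 // => j /negbTE ji.
by rewrite ffunE eq_sym ji.
Qed.

Lemma evecC (i k : 'I_n.+1) : evec i k = evec k i.
Proof. by rewrite !ffunE eq_sym. Qed.

Lemma otens1l m : otens r (evec ord0) m = m.
Proof.
apply/ffunP => k; rewrite ffunE.
under eq_bigr do under eq_bigr do rewrite -mulnA.
under eq_bigr do rewrite -big_distrr /=.
rewrite sum_evecl.
by under eq_bigr do rewrite zc1l evecC mulnC; rewrite sum_evecl.
Qed.

Lemma otens1r m : otens r m (evec ord0) = m.
Proof.
apply/ffunP => k; rewrite ffunE exchange_big /=.
under eq_bigr do under eq_bigr do rewrite [(m _ * _)%N]mulnC -mulnA.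
under eq_bigr do rewrite -big_distrr /=.
rewrite sum_evecl.
by under eq_bigr do rewrite zc1r evecC mulnC; rewrite sum_evecl.
Qed.

Lemma otens_unit_mid i j :
  otens r (otens r (evec i) (evec ord0)) (evec j)
    = otens r (evec i) (otens r (evec ord0) (evec j)).
Proof. by rewrite otens1r otens1l. Qed.

End ZplusTheory.

(* Block matrices over an algebra with orthogonal idempotents *)

Record idem_system (F : fieldType) (A : falgType F) (n : nat) := IdemSystem {
  ei :> 'I_n.+1 -> A;
  ei_idem : forall i, ei i * ei i = ei i;
  ei_orth : forall i j, i != j -> ei i * ei j = 0;
  ei_sum : \sum_i ei i = 1 }.

Section BlockMatrices.
Context (F : fieldType) (A : falgType F) (n : nat) (e : idem_system A n).
Implicit Types m s t : nvec n.

(* corner i j is e_i A e_j *)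
Definition corner (i j : 'I_n.+1) : {vspace A} :=
  (<[e i]> * {:A} * <[e j]>)%VS.

Definition typed m s (X : 'M[A]_(`|m|_1, `|s|_1)) : bool :=
  [forall p, forall q, X p q \in corner (@tagnat.sig1 _ m p) (@tagnat.sig1 _ s q)].

(* bmat m s is M_{m x s}(A).  Row p of block i and column q of block j are
   tagnat.Rank i p and tagnat.Rank j q.  When m or s is zero this is the zero
   space, consisting of the unique matrix with no row or no column. *)
Record bmat m s := BMat { bmx :> 'M[A]_(`|m|_1, `|s|_1); bmxP : typed bmx }.

HB.instance Definition _ m s := [isSub for @bmx m s].
HB.instance Definition _ m s := [Choice of bmat m s by <:].

Lemma typedP m s (X : 'M[A]_(`|m|_1, `|s|_1)) :
  reflect (forall p q,
    X p q \in corner (@tagnat.sig1 _ m p) (@tagnat.sig1 _ s q)) (typed X).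
Proof. exact/'forall_forallP. Qed.

Fact typed_zmod m s : zmod_closed (@typed m s).
Proof.
split=> [|X Y /typedP hX /typedP hY]; apply/typedP => p q; rewrite !mxE ?mem0v //.
exact: memvB.
Qed.
HB.instance Definition _ m s :=
  GRing.isZmodClosed.Build _ (@typed m s) (@typed_zmod m s).
HB.instance Definition _ m s := [SubChoice_isSubZmodule of bmat m s by <:].

Fact bscale_typed (a : F) m s (X : bmat m s) : typed (map_mx ( *:%R a) X).
Proof. by apply/typedP => p q; rewrite mxE memvZ //; apply/typedP/bmxP. Qed.
Definition bscale a m s (X : bmat m s) := BMat (bscale_typed a X).

Fact bscaleA m s a b (X : bmat m s) : bscale a (bscale b X) = bscale (a * b) X.
Proof. by apply/val_inj/matrixP => p q; rewrite !mxE scalerA. Qed.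
Fact bscale1 m s : left_id 1 (fun a (X : bmat m s) => bscale a X).
Proof. by move=> X; apply/val_inj/matrixP => p q; rewrite !mxE scale1r. Qed.
Fact bscaleDr m s : right_distributive (fun a (X : bmat m s) => bscale a X) +%R.
Proof. by move=> a X Y; apply/val_inj/matrixP => p q; rewrite !mxE scalerDr. Qed.
Fact bscaleDl m s (X : bmat m s) : {morph (fun a => bscale a X) : a b / a + b}.
Proof. by move=> a b; apply/val_inj/matrixP => p q; rewrite !mxE scalerDl. Qed.
HB.instance Definition _ m s := GRing.Zmodule_isLmodule.Build F (bmat m s)
  (@bscaleA m s) (@bscale1 m s) (@bscaleDr m s) (@bscaleDl m s).

Lemma mem_corner i j x : reflect (e i * x * e j = x) (x \in corner i j).
Proof.
apply: (iffP idP) => [|<-]; last by rewrite !memv_mul ?memv_line ?memvf.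
suff /subvP sub : (corner i j <= lker (amulr (e j) \o amull (e i) - \1)%VF)%VS.
  by move/sub; rewrite memv_ker !lfun_simp /= subr_eq0 => /eqP.
apply/prodvP => u _ /[swap] /vlineP[b ->] hu; rewrite -scalerAr memvZ //.
suff /subvP sub : (<[e i]> * {:A} <= lker (amull (e i) - \1)%VF)%VS.
  move/sub: hu; rewrite !memv_ker !lfun_simp /= !subr_eq0 => /eqP hu.
  by rewrite mulrA hu -mulrA ei_idem.
apply/prodvP => _ v /vlineP[c ->] _; rewrite -scalerAl memvZ //.
by rewrite memv_ker !lfun_simp /= mulrA ei_idem subrr.
Qed.

Lemma corner_mul i j k x y :
  x \in corner i j -> y \in corner j k -> x * y \in corner i k.
Proof.
move=> /mem_corner hx /mem_corner hy; apply/mem_corner.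
by rewrite -hx -hy !mulrA ei_idem -!mulrA ei_idem.
Qed.

Lemma corner_ei i : e i \in corner i i.
Proof. by apply/mem_corner; rewrite !ei_idem. Qed.

Fact bmul_typed m s t (X : bmat m s) (Y : bmat s t) : typed (bmx X *m bmx Y).
Proof.
apply/typedP => p q; rewrite mxE memv_suml // => u _.
by apply: (corner_mul (j := tagnat.sig1 u)); apply/typedP/bmxP.
Qed.
Definition bmul m s t (X : bmat m s) (Y : bmat s t) : bmat m t :=
  BMat (bmul_typed X Y).

Fact bid_typed m :
  typed (diag_mx (\row_(p < `|m|_1) e (@tagnat.sig1 _ m p))).
Proof.
apply/typedP => p q; rewrite !mxE; case: eqP => [->|_]; rewrite ?mem0v //.
exact: corner_ei.
Qed.
(* bid m is E_m *)
Definition bid m : bmat m m := BMat (bid_typed m).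

(* E_m for an object written in two ways *)
Definition bideq m s (ms : m = s) : bmat s m :=
  ecast x (bmat x m) ms (bid m).

Lemma sig1_evec (i : 'I_n.+1) (p : 'I_`|evec i|_1) : @tagnat.sig1 _ (evec i) p = i.
Proof.
apply/esym/eqP; have := ltn_ord (@tagnat.sig2 _ (evec i) p).
by rewrite [in X in (_ < X)%N -> _]ffunE; case: eqP.
Qed.

Fact Xel_typed m i (k : 'I_(m i)) :
  @typed m (evec i) (\matrix_(p, q) if p == tagnat.Rank i k then e i else 0).
Proof.
apply/typedP => p q; rewrite mxE sig1_evec; case: eqP => [->|_]; rewrite ?mem0v //.
by rewrite tagnat.Rank1K corner_ei.
Qed.
Fact Yel_typed m i (k : 'I_(m i)) :
  @typed (evec i) m (\matrix_(p, q) if q == tagnat.Rank i k then e i else 0).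
Proof.
apply/typedP => p q; rewrite mxE sig1_evec; case: eqP => [->|_]; rewrite ?mem0v //.
by rewrite tagnat.Rank1K corner_ei.
Qed.
(* X^m_{i,k} and Y^m_{i,k}, with k counted from 0 *)
Definition Xel m i k : bmat m (evec i) := BMat (@Xel_typed m i k).
Definition Yel m i k : bmat (evec i) m := BMat (@Yel_typed m i k).

(* Annihilators *)

Definition col_independent m s (X : bmat m s) : Prop :=
  forall l (Y : bmat s l), bmul X Y = 0 -> Y = 0.

Definition row_independent m s (X : bmat m s) : Prop :=
  forall l (Y : bmat l m), bmul Y X = 0 -> Y = 0.

Definition right_univ_annihilator m s t (X : bmat m s) (Y : bmat s t) : Prop :=
  bmul X Y = 0 /\
  forall l (M : bmat s l), bmul X M = 0 -> exists! Z : bmat t l, M = bmul Y Z.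

Definition left_univ_annihilator m s t (X : bmat m s) (Y : bmat t m) : Prop :=
  bmul Y X = 0 /\
  forall l (M : bmat l m), bmul M X = 0 -> exists! Z : bmat l t, M = bmul Z Y.

(* Admissible algebras *)

Definition primitive_idem (u : A) : Prop :=
  [/\ u * u = u, u != 0 &
      forall v w : A, v * v = v -> w * w = w -> v * w = 0 -> w * v = 0 ->
        u = v + w -> v = 0 \/ w = 0].

(* B is a subspace closed under multiplication with its own unit, such as
   e_i A e_i; its left ideals are automatically subspaces. *)
Definition left_ideal (B L : {vspace A}) : Prop :=
  (L <= B)%VS /\ (B * L <= L)%VS.

Definition maximal_left_ideal (B L : {vspace A}) : Prop :=
  [/\ left_ideal B L, L <> B &
      forall L', left_ideal B L' -> (L <= L')%VS -> L' = L \/ L' = B].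

Definition in_jacobson (B : {vspace A}) (x : A) : Prop :=
  x \in B /\ forall L, maximal_left_ideal B L -> x \in L.

Record admissible_algebra : Prop := {
  adm_primitive : forall i, primitive_idem (e i);
  adm_KS : forall i j, i != j ->
    forall x, x \in (<[e i]> * {:A} * <[e j]> * {:A} * <[e i]>)%VS ->
      in_jacobson (corner i i) x;
  adm_Dec : forall m s (X : bmat m s),
    exists t (X1 : bmat m t) (X2 : bmat t s),
      [/\ X = bmul X1 X2, col_independent X1 & row_independent X2];
  adm_RUA : forall m s (X : bmat m s),
    exists t (Y : bmat s t), right_univ_annihilator X Y;
  adm_LUA : forall m s (X : bmat m s),
    exists t (Y : bmat t m), left_univ_annihilator X Y;
  adm_CI : forall m s t (X : bmat m s) (Y : bmat t m),
    col_independent X -> left_univ_annihilator X Y ->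
    right_univ_annihilator Y X;
  adm_RI : forall m s t (X : bmat m s) (Y : bmat s t),
    row_independent X -> right_univ_annihilator X Y ->
    left_univ_annihilator Y X }.

End BlockMatrices.

(* The datum (R, A, phi, a) *)

Section Datum.
Context (R : pzRingType) (n : nat) (r : zplus_basis R n).
Context (F : fieldType) (A : falgType F) (e : idem_system A n).
Implicit Types m s t : nvec n.
Local Notation "m ** s" := (otens r m s) (at level 40, left associativity).
Local Notation "X ∘ Y" := (bmul X Y) (at level 40, left associativity).
Local Notation ee i := (evec i).
Local Notation c := (zc r).

(* M(R,A,I); the component at i' j' i j lies in M_{c_{i'j'} x c_{ij}}(A) *)
Definition MRAI := forall i' j' i j : 'I_n.+1, bmat e (c i' j') (c i j).

Definition mulMRAI (X Y : MRAI) : MRAI :=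
  fun i' j' i j => \sum_k \sum_l X i' j' k l ∘ Y k l i j.

(* Z is the matrix X of the summand M_{c_{i'j'} x c_{ij}}(A) *)
Definition in_summand (Z : MRAI) i' j' i j
    (X : 'M[A]_(`|c i' j'|_1, `|c i j|_1)) : Prop :=
  bmx (Z i' j' i j) = X /\
  forall k' l' k l, (k', l', k, l) != (i', j', i, j) -> Z k' l' k l = 0.

(* An F-algebra map A (x) A -> M(R,A,I), given on pure tensors by
   phi (x (x) y) = phi x y: a bilinear map which respects the product
   (x (x) y) (x' (x) y') = xx' (x) yy'.  The unit of M(R,A,I) is the sum of
   the E_{c_ij}, so unitality is contained in phi1 below. *)
Record tensor_alg_map (phi : A -> A -> MRAI) : Prop := {
  phi_linear_l : forall a x x' y i' j' i j,
    phi (a *: x + x') y i' j' i j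
      = a *: phi x y i' j' i j + phi x' y i' j' i j;
  phi_linear_r : forall a x y y' i' j' i j,
    phi x (a *: y + y') i' j' i j
      = a *: phi x y i' j' i j + phi x y' i' j' i j;
  phi_mul : forall x x' y y' i' j' i j,
    phi (x * x') (y * y') i' j' i j
      = mulMRAI (phi x y) (phi x' y') i' j' i j }.

Context (phi : A -> A -> MRAI).

Definition phi1 : Prop :=
  forall i j, in_summand (phi (e i) (e j)) (bmx (bid e (c i j))).

(* The matrices of phi2 are 1 x 1 since c_{1i} = c_{i1} = e_i. *)
Definition phi2 : Prop :=
  forall i j a, a \in corner e i j ->
    @in_summand (phi (e ord0) a) ord0 i ord0 j (const_mx a) /\
    @in_summand (phi a (e ord0)) i ord0 j ord0 (const_mx a).

(* The tensor product of matrices.  The block rows of phi(X (x) Y) are numbered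
   by l : 'I_(|s2| * |s1|), where l = q * |s1| + p corresponds to row p of X
   and row q of Y. *)
Definition brow1 s1 s2 (l : 'I_(`|s2|_1 * `|s1|_1)) : 'I_`|s1|_1 :=
  (mxtens_unindex l).2.
Definition brow2 s1 s2 (l : 'I_(`|s2|_1 * `|s1|_1)) : 'I_`|s2|_1 :=
  (mxtens_unindex l).1.
Definition btype1 s1 s2 (l : 'I_(`|s2|_1 * `|s1|_1)) : 'I_n.+1 :=
  @tagnat.sig1 _ s1 (brow1 l).
Definition btype2 s1 s2 (l : 'I_(`|s2|_1 * `|s1|_1)) : 'I_n.+1 :=
  @tagnat.sig1 _ s2 (brow2 l).
Definition bdim s1 s2 (l : 'I_(`|s2|_1 * `|s1|_1)) : nvec n :=
  c (btype1 l) (btype2 l).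

Definition phi_tensor s1 m1 s2 m2 (X : bmat e s1 m1) (Y : bmat e s2 m2) :
    'M[A]_(\sum_(l < `|s2|_1 * `|s1|_1) `|bdim l|_1,
           \sum_(k < `|m2|_1 * `|m1|_1) `|bdim k|_1) :=
  \mxblock_(l, k) bmx (phi (bmx X (brow1 l) (brow1 k)) (bmx Y (brow2 l) (brow2 k))
                           (btype1 l) (btype2 l) (btype1 k) (btype2 k)).

Lemma mxblock_Rank T k l (p : 'I_k -> nat) (q : 'I_l -> nat)
    (B : forall i j, 'M[T]_(p i, q j)) i j u v :
  (\mxblock_(i, j) B i j) (tagnat.Rank i u) (tagnat.Rank j v) = B i j u v.
Proof. by have /matrixP/(_ u v) := mxblockK B i j; rewrite mxE. Qed.

Lemma sum_sig1 m (f : 'I_n.+1 -> nat) :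
  (\sum_(p < `|m|_1) f (@tagnat.sig1 _ m p) = \sum_i m i * f i)%N.
Proof.
rewrite (reindex _ (onW_bij _ (@tagnat.rank_bij _ m))) /=.
rewrite (eq_bigr (fun p : {i & 'I_(m i)} => f (tag p))); last first.
  by move=> p _; rewrite tagnat.rankE tagnat.Rank1K.
rewrite -(@sig_big_dep _ _ _ _ _ xpredT (fun=> xpredT) (fun i _ => f i)) /=.
by apply: eq_bigr => i _; rewrite sum_nat_const card_ord.
Qed.

Lemma otensE s1 s2 k :
  otens r s1 s2 k = (\sum_(l < `|s2|_1 * `|s1|_1) bdim l k)%N.
Proof.
rewrite (reindex (@mxtens_index _ _)) /=; last first.
  by exists (@mxtens_unindex _ _) => x _; rewrite (mxtens_indexK, mxtens_unindexK).
under eq_bigr do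
  rewrite /bdim /btype1 /btype2 /brow1 /brow2 mxtens_indexK.
rewrite -(pair_bigA _ (fun q p =>
  c (@tagnat.sig1 _ s1 p) (@tagnat.sig1 _ s2 q) k)) /= exchange_big /= ffunE.
rewrite (sum_sig1 _ (fun i => \sum_q c i (@tagnat.sig1 _ s2 q) k)%N).
apply: eq_bigr => i _; rewrite (sum_sig1 _ (fun j => c i j k)) big_distrr /=.
by apply: eq_bigr => j _; rewrite mulnA.
Qed.

(* The permutation Pi: row p of the result, the r-th one of type k, is the r-th
   row of type k of phi(X (x) Y), counted through the block rows l in order. *)
Definition Pi_index s1 s2 (p : 'I_`|s1 ** s2|_1) :
    'I_(\sum_(l < `|s2|_1 * `|s1|_1) `|bdim l|_1) :=
  let k := tagnat.sig1 p in
  let x := cast_ord (otensE s1 s2 k) (tagnat.sig2 p) in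
  tagnat.Rank (tagnat.sig1 x) (@tagnat.Rank _ (bdim (tagnat.sig1 x)) k (tagnat.sig2 x)).

Fact btens_typed s1 m1 s2 m2 (X : bmat e s1 m1) (Y : bmat e s2 m2) :
  @typed _ _ _ e (s1 ** s2) (m1 ** m2)
    (mxsub (@Pi_index s1 s2) (@Pi_index m1 m2) (phi_tensor X Y)).
Proof.
apply/typedP => p q; rewrite mxE /Pi_index /phi_tensor.
rewrite mxblock_Rank; set Z := phi _ _ _ _ _ _.
set u := tagnat.Rank _ _; set v := tagnat.Rank _ _.
by have /typedP/(_ u v) := bmxP Z; rewrite !tagnat.Rank1K.
Qed.
Definition btens s1 m1 s2 m2 (X : bmat e s1 m1) (Y : bmat e s2 m2) :
  bmat e (s1 ** s2) (m1 ** m2) := BMat (btens_typed X Y).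
Local Notation "X ⊗ Y" := (btens X Y) (at level 40, left associativity).

(* Associator systems.  Since e_i ** (e_j ** e_l) and (e_i ** e_j) ** e_l are
   equal but not convertible, the elements a_{i,j,l} are typed as morphisms
   from the second to the first; for the same reason c_ij is written
   e_i ** e_j in ass_pentagon. *)
Definition ass_family :=
  forall i j l, bmat e (ee i ** (ee j ** ee l)) ((ee i ** ee j) ** ee l).

Context (a : ass_family).

Record associator_system : Prop := {
  ass_invertible : forall i j l,
    exists b : bmat e ((ee i ** ee j) ** ee l) (ee i ** (ee j ** ee l)),
      b ∘ a i j l = bid e _ /\ a i j l ∘ b = bid e _;
  ass_natural : forall i j l i' j' l'
      (x : bmat e (ee i') (ee i)) (y : bmat e (ee j') (ee j))
      (z : bmat e (ee l') (ee l)),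
    (x ⊗ (y ⊗ z)) ∘ a i j l = a i' j' l' ∘ ((x ⊗ y) ⊗ z);
  ass_unit : forall i j, a i ord0 j = bideq e (otens_unit_mid r i j);
  ass_pentagon : forall i1 i2 i3 i4,
    \sum_j \sum_(k < (ee i2 ** ee i3) j)
      (bid e (ee i1) ⊗ (a i2 i3 i4 ∘ (Xel e k ⊗ bid e (ee i4))))
      ∘ a i1 j i4
      ∘ (((bid e (ee i1) ⊗ Yel e k) ∘ a i1 i2 i3) ⊗ bid e (ee i4))
    = \sum_j \sum_j' \sum_(k < (ee i3 ** ee i4) j)
      \sum_(k' < (ee i1 ** ee i2) j')
      (bid e (ee i1) ⊗ (bid e (ee i2) ⊗ Xel e k))
      ∘ a i1 i2 j
      ∘ (Xel e k' ⊗ Yel e k)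
      ∘ a j' i3 i4
      ∘ ((Yel e k' ⊗ bid e (ee i3)) ⊗ bid e (ee i4)) }.

Definition associator m s t : bmat e (m ** (s ** t)) ((m ** s) ** t) :=
  \sum_i \sum_j \sum_l
    \sum_(k1 < m i) \sum_(k2 < s j) \sum_(k3 < t l)
      (Xel e k1 ⊗ (Xel e k2 ⊗ Xel e k3)) ∘ a i j l
      ∘ ((Yel e k1 ⊗ Yel e k2) ⊗ Yel e k3).

Record admissible_datum : Prop := {
  datum_nonzero : forall i j, r i * r j != 0;
  datum_admissible : admissible_algebra e;
  datum_dim : \dim (corner e ord0 ord0) = 1%N;
  datum_phi : tensor_alg_map phi;
  datum_phi1 : phi1;
  datum_phi2 : phi2;
  datum_ass : associator_system }.

Definition Chat : monoidal_data F :=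
  @MonoidalData F (nvec n)
    (fun m s => bmat e s m)
    (fun m => bid e m)
    (fun _ _ _ g f => g ∘ f)
    (fun m s => m ** s)
    (fun _ _ _ _ f g => f ⊗ g)
    (ee ord0)
    associator
    (fun m => bideq e (otens1l r m))
    (fun m => bideq e (otens1r r m)).

End Datum.

(* Main.v *)
Require Import Defs.
From mathcomp Require Import all_boot all_order all_algebra falgebra.
From mathcomp Require Import mxtens.

(** The objects of the category are formal direct sums: the identities
    [Yel k ∘ Xel k = e_i] and [\sum Xel k ∘ Yel k = E_m] say that [m] is the
    direct sum of [m i] copies of each [evec i].  The proof therefore has two
    layers.

    The concrete layer shows that [btens] is a bilinear bifunctor.  An entry of
    [X ⊗ Y] is an entry of a block [phi x y]; since [phi] is multiplicative and
    [phi (e i) (e j)] is the projector [E_{c_ij}], [phi] sends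
    [e_i' A e_i (x) e_j' A e_j] to a single summand and composition there is
    matrix multiplication ([phi_comp]).  Block multiplication then gives
    functoriality before the rows and columns are sorted, and sorting changes
    nothing because it is a bijection of the indices ([Pi_index_bij]), the same
    on both sides of a product.  When one factor is the unit object, every block
    has size one, and the sorting is an increasing bijection between equal
    intervals, hence the identity ([Pi_block_unit]); with phi2 this makes
    [E_{e_1} ⊗ f] equal to [f], up to the equality of objects, which is the
    naturality of the unit constraints.

    The formal layer extends the axioms on the family [a] from the basic objects
    [evec i] to all objects.  The associator is the unique morphism which acts
    as [a i j l] on every basic summand ([associator_basis]), so it inherits
    naturality and invertibility from [a].  A morphism out of a tensor product
    is determined by its composites with tensor products of the inclusions
    [Xel k], and naturality slides these inclusions through every side of the
    triangle and of the pentagon; both thus reduce to basic objects.  There the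
    triangle is the normalisation [a i 1 j = E], and the pentagon is the
    equation of the associator system, once the composite objects
    [evec i ** evec j] inside the associators are decomposed. *)

Set Implicit Arguments.
Unset Strict Implicit.
Unset Printing Implicit Defensive.

Import Order.TTheory GRing.Theory.
Local Open Scope ring_scope.

Lemma sum_of_linear (F : fieldType) (U V : lmodType F) (f : U -> V)
    (lin : forall a x y, f (a *: x + y) = a *: f x + f y)
    (I : Type) (s : seq I) (P : pred I) (G : I -> U) :
  f (\sum_(i <- s | P i) G i) = \sum_(i <- s | P i) f (G i).
Proof.
apply: (big_morph f) => [x y|]; first by rewrite -[x]scale1r lin !scale1r.
by have := lin (-1) 0 0; rewrite scaler0 addr0 scaleN1r addNr.
Qed.

(** * The linear category of block matrices *)

Section BlockCategory.
Context (F : fieldType) (A : falgType F) (n : nat) (e : idem_system A n).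
Implicit Types m s t : nvec n.
Local Notation "X ∘ Y" := (bmul X Y) (at level 40, left associativity).
Local Notation "`1 m" := (bid e m) (at level 8, m at level 2, format "`1 m").

Lemma bmat_eqP m s (X Y : bmat e m s) : (forall p q, bmx X p q = bmx Y p q) -> X = Y.
Proof. by move=> XY; apply/val_inj/matrixP. Qed.

Lemma bmat_corner m s (X : bmat e m s) p q :
  bmx X p q \in corner e (@tagnat.sig1 _ m p) (@tagnat.sig1 _ s q).
Proof. by have /typedP := bmxP X. Qed.

Lemma corner_idl i j x : x \in corner e i j -> e i * x = x.
Proof. by move/mem_corner=> <-; rewrite !mulrA ei_idem. Qed.

Lemma corner_idr i j x : x \in corner e i j -> x * e j = x.
Proof. by move/mem_corner=> <-; rewrite -!mulrA ei_idem. Qed.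

Lemma bmulA m s t l (X : bmat e m s) (Y : bmat e s t) (Z : bmat e t l) :
  X ∘ (Y ∘ Z) = X ∘ Y ∘ Z.
Proof. exact/val_inj/mulmxA. Qed.

Lemma bmul1l m s (X : bmat e m s) : `1 m ∘ X = X.
Proof.
apply: bmat_eqP => p q; rewrite /bmul /bid /= mul_diag_mx !mxE.
exact/corner_idl/bmat_corner.
Qed.

Lemma bmul1r m s (X : bmat e m s) : X ∘ `1 s = X.
Proof.
apply: bmat_eqP => p q; rewrite /bmul /bid /= mul_mx_diag !mxE.
exact/corner_idr/bmat_corner.
Qed.

Lemma bmul_linear_l m s t (Y : bmat e s t) a (X X' : bmat e m s) :
  (a *: X + X') ∘ Y = a *: (X ∘ Y) + X' ∘ Y.
Proof.
apply: bmat_eqP => p q; rewrite !mxE scaler_sumr -big_split.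
by apply: eq_bigr => u _; rewrite !mxE mulrDl scalerAl.
Qed.

Lemma bmul_linear_r m s t (X : bmat e m s) a (Y Y' : bmat e s t) :
  X ∘ (a *: Y + Y') = a *: (X ∘ Y) + X ∘ Y'.
Proof.
apply: bmat_eqP => p q; rewrite !mxE scaler_sumr -big_split.
by apply: eq_bigr => u _; rewrite !mxE mulrDr scalerAr.
Qed.

Lemma bmul_suml m s t (Y : bmat e s t) (I : finType) (X : I -> bmat e m s) :
  (\sum_i X i) ∘ Y = \sum_i X i ∘ Y.
Proof. exact/(sum_of_linear (f := fun X => X ∘ Y))/bmul_linear_l. Qed.

Lemma bmul_sumr m s t (X : bmat e m s) (I : finType) (Y : I -> bmat e s t) :
  X ∘ (\sum_i Y i) = \sum_i X ∘ Y i.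
Proof. exact/(sum_of_linear (f := bmul X))/bmul_linear_r. Qed.

Lemma bmul_sum m s t (I J : finType) (X : I -> bmat e m s) (Y : J -> bmat e s t) :
  (\sum_i X i) ∘ (\sum_j Y j) = \sum_i \sum_j X i ∘ Y j.
Proof. by rewrite bmul_suml; apply: eq_bigr => i _; rewrite bmul_sumr. Qed.

Lemma bmul0l m s t (Y : bmat e s t) : 0 ∘ Y = 0 :> bmat e m t.
Proof. exact/val_inj/mul0mx. Qed.

Lemma bmul0r m s t (X : bmat e m s) : X ∘ 0 = 0 :> bmat e m t.
Proof. exact/val_inj/mulmx0. Qed.

Lemma bmx_sum m s (I : finType) (X : I -> bmat e m s) :
  bmx (\sum_i X i) = \sum_i bmx (X i).
Proof. by apply: (big_morph (@bmx _ _ _ e m s)). Qed.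

Lemma card_evec (i : 'I_n.+1) : (`|evec i|_1 = 1)%N.
Proof. by under eq_bigr do rewrite -[evec i _]muln1; rewrite sum_evecl. Qed.

Lemma evec_row_eq (i : 'I_n.+1) (p q : 'I_`|evec i|_1) : p = q.
Proof. by case: p q; rewrite card_evec => -[|//] ? [[|//] ?]; apply: val_inj. Qed.

Lemma sum_tagnat (V : nmodType) m (G : forall i, 'I_(m i) -> V) :
  \sum_i \sum_(k < m i) G i k = \sum_(p < `|m|_1) G _ (@tagnat.sig2 _ m p).
Proof.
rewrite sig_big_dep /= (reindex _ (onW_bij _ (@tagnat.sig_bij _ m))) /=.
by apply: eq_bigr.
Qed.

(** The inclusions [Xel k] and projections [Yel k] present [m] as a direct sum
    of basic objects: the summand of index [p] is the diagonal matrix unit at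
    [p].  All reductions to basic objects come from this identity. *)
Lemma sum_Xel_Yel m : \sum_i \sum_(k < m i) Xel e k ∘ Yel e k = `1 m.
Proof.
rewrite (sum_tagnat (fun i k => Xel e k ∘ Yel e k)).
apply: bmat_eqP => p q; rewrite !mxE.
rewrite (big_morph (fun X : bmat e m m => bmx X p q) (id1 := 0) (op1 := +%R));
  [|by move=> X Y; rewrite !mxE|by rewrite mxE].
rewrite (bigD1 p) //= [X in _ + X]big1 => [|u up]; last first.
  rewrite mxE big1 // => v _; rewrite !mxE tagnat.sig2K.
  by rewrite eq_sym (negbTE up) mul0r.
rewrite [LHS]addr0 mxE.
have v : 'I_`|evec (@tagnat.sig1 _ m p)|_1 by rewrite card_evec; exact: ord0.
rewrite (bigD1 v) //= [X in _ + X]big1 => [|w /eqP[]]; last exact: evec_row_eq.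
rewrite [LHS]addr0 !mxE tagnat.sig2K eqxx eq_sym.
by case: eqP => [|_]; rewrite ?mulr0 // mulr1n ei_idem.
Qed.

Lemma bideq_refl m : bideq e (erefl m) = `1 m.
Proof. by []. Qed.

Lemma bideq_trans m s t (E1 : m = s) (E2 : s = t) (E3 : m = t) :
  bideq e E2 ∘ bideq e E1 = bideq e E3.
Proof.
case: _ / E2 in E3 *; rewrite (eq_irrelevance E3 E1); case: _ / E1 {E3}.
by rewrite !bideq_refl bmul1l.
Qed.

(** Composing with an identity between two names of the same object only renames
    the columns, or the rows in the next lemma. *)
Lemma bmul_bideq m s t (ms : m = s) (X : bmat e t s) (E : `|m|_1%N = `|s|_1%N) p q :
  bmx (X ∘ bideq e ms) p q = bmx X p (cast_ord E q).
Proof. by case: _ / ms in X E *; rewrite bideq_refl bmul1r cast_ord_id. Qed.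

Lemma bideq_bmul m s t (ms : m = s) (X : bmat e m t) (E : `|s|_1%N = `|m|_1%N) p q :
  bmx (bideq e ms ∘ X) p q = bmx X (cast_ord E p) q.
Proof. by case: _ / ms in E p *; rewrite bideq_refl bmul1l cast_ord_id. Qed.

Lemma bideq_isom m s (ms : m = s) :
  exists Y : bmat e m s, Y ∘ bideq e ms = `1 m /\ bideq e ms ∘ Y = `1 s.
Proof. by exists (bideq e (esym ms)); split; apply: (bideq_trans _ _ erefl). Qed.

End BlockCategory.

(** * The sorting permutation and the bifunctor *)

Section TensorProduct.
Context (R : pzRingType) (n : nat) (r : zplus_basis R n).
Context (F : fieldType) (A : falgType F) (e : idem_system A n).
Implicit Types m s t : nvec n.
Local Notation "m ** s" := (otens r m s) (at level 40, left associativity).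
Local Notation "X ∘ Y" := (bmul X Y) (at level 40, left associativity).
Local Notation "`1 m" := (bid e m) (at level 8, m at level 2, format "`1 m").
Local Notation c := (zc r).
Context (phi : A -> A -> MRAI r e).
Context (phi_map : tensor_alg_map phi) (phi_id : phi1 phi) (phi_unit : phi2 phi).

(** The image of [p] records a block row [l], a type [k] and a position inside
    them, and [p] is recovered as the row of type [k] with the rank of
    ([l], position) among the rows of type [k].  The local facts only deal with
    the dependency of positions on [l] and [k]. *)
Lemma Pi_index_inj s t : injective (@Pi_index _ _ r s t).
Proof.
have tagnat_inj k (d : 'I_k -> nat) (x y : 'I_(\sum_i d i)) :
    tagnat.sig1 x = tagnat.sig1 y -> tagnat.sig2 x = tagnat.sig2 y :> nat -> x = y.
  move=> xy1 xy2; rewrite -[x]tagnat.sig2K -[y]tagnat.sig2K; apply/val_inj/eqP.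
  by rewrite tagnat.eq_Rank; apply/andP; split; apply/eqP.
have inner k l (x : 'I_(\sum_u (@bdim _ _ r s t u) k)) (y : 'I_(\sum_u (@bdim _ _ r s t u) l)) :
    k = l -> tagnat.sig1 x = tagnat.sig1 y -> tagnat.sig2 x = tagnat.sig2 y :> nat ->
    x = y :> nat.
  by move=> kl; case: _ / kl in y *; move=> xy1 xy2; rewrite (tagnat_inj _ _ _ _ xy1 xy2).
have Rank_inj k (d d' : 'I_k -> nat) i i' (u : 'I_(d i)) (v : 'I_(d' i')) :
    d = d' -> tagnat.Rank i u = tagnat.Rank i' v :> nat -> i = i' /\ u = v :> nat.
  by move=> dd; case: _ / dd in v * => /eqP; rewrite tagnat.eq_Rank => /andP[/eqP ? /eqP].
move=> p q; rewrite /Pi_index; set x := cast_ord _ _; set y := cast_ord _ _.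
move=> /(congr1 val)/eqP; rewrite tagnat.eq_Rank => /andP[/eqP xy1 /eqP row_eq].
have [kl xy2] := Rank_inj _ _ _ _ _ _ _ (congr1 (fun l => bdim r l : _ -> _) xy1) row_eq.
exact/tagnat_inj/(inner _ _ x y kl xy1 xy2).
Qed.

Lemma Pi_index_bij s t : bijective (@Pi_index _ _ r s t).
Proof.
apply: (inj_card_bij (@Pi_index_inj s t)); rewrite !card_ord.
by under [leqRHS]eq_bigr do rewrite otensE; rewrite exchange_big.
Qed.

Lemma phi_linl a x x' y i' j' i j :
  phi (a *: x + x') y i' j' i j = a *: phi x y i' j' i j + phi x' y i' j' i j.
Proof. by case: phi_map. Qed.

Lemma phi_linr a x y y' i' j' i j :
  phi x (a *: y + y') i' j' i j = a *: phi x y i' j' i j + phi x y' i' j' i j.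
Proof. by case: phi_map. Qed.

Lemma phi_suml (I : finType) (x : I -> A) y i' j' i j :
  phi (\sum_u x u) y i' j' i j = \sum_u phi (x u) y i' j' i j.
Proof.
by apply: (sum_of_linear (f := fun x => phi x y i' j' i j)) => *; exact: phi_linl.
Qed.

Lemma phi_sumr (I : finType) x (y : I -> A) i' j' i j :
  phi x (\sum_u y u) i' j' i j = \sum_u phi x (y u) i' j' i j.
Proof.
by apply: (sum_of_linear (f := fun y => phi x y i' j' i j)) => *; exact: phi_linr.
Qed.

Lemma phi_sum (I J : finType) (x : I -> A) (y : J -> A) i' j' i j :
  phi (\sum_u x u) (\sum_v y v) i' j' i j
  = \sum_(p : J * I) phi (x p.2) (y p.1) i' j' i j.
Proof.
rewrite -(pair_bigA _ (fun v u => phi (x u) (y v) i' j' i j)) /= phi_sumr.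
by apply: eq_bigr => v _; rewrite phi_suml.
Qed.

Lemma phi_0l y i' j' i j : phi 0 y i' j' i j = 0.
Proof. by have := phi_suml (I := 'I_0) (fun=> 0) y i' j' i j; rewrite !big_ord0. Qed.

Lemma phi_0r x i' j' i j : phi x 0 i' j' i j = 0.
Proof. by have := phi_sumr (I := 'I_0) x (fun=> 0) i' j' i j; rewrite !big_ord0. Qed.

Lemma phi_ei i j : phi (e i) (e j) i j i j = `1 (c i j).
Proof. by apply: val_inj; case: (phi_id i j). Qed.

Lemma phi_ei_off i j k' l' k l : (k', l', k, l) != (i, j, i, j) ->
  phi (e i) (e j) k' l' k l = 0.
Proof. by case: (phi_id i j) => _; exact. Qed.

(** Absorbing [e i] and [e j] on the right of [x] and [y] factors [phi x y]
    through the projector [phi (e i) (e j)], which lives in a single summand. *)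
Lemma phi_corner_off x y i' j' i j k l :
  x \in corner e i' i -> y \in corner e j' j -> (k, l) != (i, j) ->
  phi x y i' j' k l = 0.
Proof.
move=> /corner_idr {1}<- /corner_idr {1}<- kl; rewrite (phi_mul phi_map) /mulMRAI.
rewrite big1 // => u _; rewrite big1 // => v _; rewrite phi_ei_off ?bmul0r //.
by apply: contraNneq kl => -[_ _ -> ->].
Qed.

(** The product of the big algebra sums over all intermediate summands; only the
    one singled out by the types of [x] and [y] contributes. *)
Lemma phi_comp x y x' y' i' j' k l i j :
  x \in corner e i' k -> y \in corner e j' l ->
  phi (x * x') (y * y') i' j' i j = phi x y i' j' k l ∘ phi x' y' k l i j.
Proof.
move=> xP yP; rewrite (phi_mul phi_map) /mulMRAI (bigD1 k) //= (bigD1 l) //=.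
rewrite !big1 ?addr0 // => [u uk|v vl].
  rewrite big1 // => v _; rewrite (phi_corner_off xP yP) ?bmul0l //.
  by apply: contraNneq uk => -[->].
rewrite (phi_corner_off xP yP) ?bmul0l //.
by apply: contraNneq vl => -[->].
Qed.

Local Notation "X ⊗ Y" := (btens phi X Y) (at level 40, left associativity).

Lemma btens_linear_l s1 m1 s2 m2 (Y : bmat e s2 m2) a (X X' : bmat e s1 m1) :
  (a *: X + X') ⊗ Y = a *: (X ⊗ Y) + X' ⊗ Y.
Proof. by apply: bmat_eqP => p q; rewrite !mxE phi_linl !mxE. Qed.

Lemma btens_linear_r s1 m1 s2 m2 (X : bmat e s1 m1) a (Y Y' : bmat e s2 m2) :
  X ⊗ (a *: Y + Y') = a *: (X ⊗ Y) + X ⊗ Y'.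
Proof. by apply: bmat_eqP => p q; rewrite !mxE phi_linr !mxE. Qed.

(** Before sorting this is block multiplication: the sum over pairs of inner
    indices of [X ∘ X'] and [Y ∘ Y'] is the sum over the inner block index. *)
Lemma btens_comp s1 s2 m1 m2 t1 t2 (X : bmat e s1 m1) (X' : bmat e m1 t1)
    (Y : bmat e s2 m2) (Y' : bmat e m2 t2) :
  (X ∘ X') ⊗ (Y ∘ Y') = (X ⊗ Y) ∘ (X' ⊗ Y').
Proof.
apply: val_inj => /=.
have -> : phi_tensor phi (X ∘ X') (Y ∘ Y') = phi_tensor phi X Y *m phi_tensor phi X' Y'.
  rewrite mul_mxblock; apply: eq_mxblock => l k.
  rewrite /bmul /= !mxE phi_sum bmx_sum [RHS](reindex (@mxtens_index _ _)) /=; last first.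
    by exists (@mxtens_unindex _ _) => ? _; rewrite ?mxtens_indexK ?mxtens_unindexK.
  apply: eq_bigr => -[v u] _ /=; set j := mxtens_index (v, u).
  (* u and v occur in the types of the blocks only through j *)
  have [ju jv] : u = brow1 j /\ v = brow2 j by rewrite /brow1 /brow2 mxtens_indexK.
  move: j ju jv => j -> ->.
  by rewrite (@phi_comp _ _ _ _ _ _ (btype1 j) (btype2 j)) //; apply: bmat_corner.
(* sorting permutes the inner index of the product bijectively *)
apply/matrixP => p q; rewrite !mxE (reindex _ (onW_bij _ (Pi_index_bij m1 m2))) /=.
by apply: eq_bigr => u _; rewrite !mxE.
Qed.

(** Before sorting, the tensor product of two identities is the diagonal matrix
    whose entry in a row of type [i] is [e i]: off-diagonal blocks are values of
    [phi] at zero, diagonal ones are given by phi1. *)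
Lemma phi_id_entry m s (l k : 'I_(`|s|_1 * `|m|_1)) w z :
  bmx (phi (bmx `1 m (brow1 l) (brow1 k)) (bmx `1 s (brow2 l) (brow2 k))
         (btype1 l) (btype2 l) (btype1 k) (btype2 k)) w z
  = e (@tagnat.sig1 _ (@bdim _ _ r m s l) w)
      *+ (@tagnat.Rank _ (fun l => `|@bdim _ _ r m s l|_1) l w
          == @tagnat.Rank _ (fun l => `|@bdim _ _ r m s l|_1) k z).
Proof.
have -> : (@tagnat.Rank _ (fun l => `|@bdim _ _ r m s l|_1) l w == tagnat.Rank k z)
    = (l == k) && (w == z :> nat) by exact: tagnat.eq_Rank.
have [lk|lk] := eqVneq l k.
  by case: _ / lk in z *; rewrite /= !mxE !eqxx phi_ei !mxE.
rewrite mulr0n /= !mxE.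
have [row1|_] := eqVneq (brow1 l) (brow1 k); last by rewrite phi_0l mxE.
have [row2|_] := eqVneq (brow2 l) (brow2 k); last by rewrite phi_0r mxE.
case/eqP: lk; apply: (can_inj (@mxtens_unindexK _ _)).
by rewrite (surjective_pairing (mxtens_unindex l)) (surjective_pairing (mxtens_unindex k));
  congr pair.
Qed.

Lemma btens_id m s : `1 m ⊗ `1 s = `1 (m ** s).
Proof.
apply: bmat_eqP => p q; rewrite mxE /Pi_index /phi_tensor mxblock_Rank phi_id_entry.
rewrite tagnat.Rank1K -/(Pi_index p) -/(Pi_index q) !mxE.
by rewrite (inj_eq (@Pi_index_inj m s)).
Qed.
(** * The unit object *)

Definition Pi_block s t (p : 'I_`|s ** t|_1) : 'I_(`|t|_1 * `|s|_1) :=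
  tagnat.sig1 (cast_ord (otensE r s t (tagnat.sig1 p)) (tagnat.sig2 p)).

Lemma btens_entry s1 m1 s2 m2 (X : bmat e s1 m1) (Y : bmat e s2 m2) p q :
  let l := Pi_block p in let k := Pi_block q in exists u v,
  bmx (X ⊗ Y) p q = bmx (phi (bmx X (brow1 l) (brow1 k)) (bmx Y (brow2 l) (brow2 k))
                      (btype1 l) (btype2 l) (btype1 k) (btype2 k)) u v.
Proof.
move=> l k; rewrite mxE /Pi_index /phi_tensor mxblock_Rank.
by do 2!eexists.
Qed.

(** If block row [l] consists of one row, whose type is that of row [g l] of [m],
    with [g] increasing, then sorting by type does nothing.  Indeed the rows of
    [m] are themselves sorted by type, so the block row containing [p] increases
    with [p], and an increasing map between intervals of the same length is
    unique. *)
Lemma Pi_block_unit s t m (g : 'I_(`|t|_1 * `|s|_1) -> 'I_`|m|_1)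
    (E : `|s ** t|_1%N = `|m|_1%N) :
  {homo g : l k / (l < k)%N} ->
  (forall l, bdim r l = evec (tagnat.sig1 (g l))) ->
  forall p, g (Pi_block p) = cast_ord E p.
Proof.
move=> g_incr g_dim.
have type_of_row l k (v : 'I_(bdim r l k)) : tagnat.sig1 (g l) = k.
  by apply/eqP; have := ltn_ord v; rewrite [in X in (_ < X)%N]g_dim ffunE; case: eqP.
have g_type p : tagnat.sig1 (g (Pi_block p)) = tagnat.sig1 p.
  exact: type_of_row (tagnat.sig2 (cast_ord (otensE r s t (tagnat.sig1 p)) (tagnat.sig2 p))).
have sig1_incr k k' (x : 'I_(\sum_(l < `|t|_1 * `|s|_1) bdim r l k)) 
    (y : 'I_(\sum_(l < `|t|_1 * `|s|_1) bdim r l k')) :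
    k = k' -> (x < y)%N -> (tagnat.sig1 x < tagnat.sig1 y)%N.
  move=> kk; case: _ / kk in y * => xy.
  have sig2_0 (z : 'I_(\sum_(l < `|t|_1 * `|s|_1) bdim r l k)) : tagnat.sig2 z = 0 :> nat.
    apply/eqP; rewrite -leqn0 -ltnS (leq_trans (ltn_ord _)) // g_dim ffunE.
    exact: leq_b1.
  have le_xy : (tagnat.sig1 x <= tagnat.sig1 y)%N by exact: tagnat.le_sig1 (ltnW xy).
  rewrite ltn_neqAle le_xy andbT; apply: contraTneq xy => xy1.
  rewrite -leqNgt [X in (X <= _)%N]tagnat.rect [X in (_ <= X)%N]tagnat.rect !sig2_0.
  by under [X in (X + _ <= _)%N]eq_bigl do rewrite -xy1.
apply: Order.mono_unique => [|||//]; first exact: le_total.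
  by rewrite !card_ord E.
(* rows are ordered by type first, then by rank within their type *)
apply: le_mono => p q pq /=.
have := tagnat.le_sig1 (ltW pq); rewrite le_eqVlt => /orP[/eqP pq1|pq1].
  apply: g_incr; apply: sig1_incr => //=.
  have : (p < q)%N by [].
  rewrite [X in (X < _)%N](tagnat.rect p) [X in (_ < X)%N](tagnat.rect q).
  under [X in (X + _ < _)%N]eq_bigl do rewrite pq1.
  by rewrite ltn_add2l.
rewrite ltNge; apply: contraTN pq1 => /tagnat.le_sig1.
by rewrite !g_type -leNgt.
Qed.

Lemma phi_unit_l i' j' i j a u v : i' = ord0 -> i = ord0 -> a \in corner e j' j ->
  bmx (phi (e ord0) a i' j' i j) u v = a.
Proof.
move=> i'0 i0; case: _ / (esym i'0) in u *; case: _ / (esym i0) in v *.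
by move=> /phi_unit[[-> _] _]; rewrite mxE.
Qed.

Lemma phi_unit_r i' j' i j a u v : j' = ord0 -> j = ord0 -> a \in corner e i' i ->
  bmx (phi a (e ord0) i' j' i j) u v = a.
Proof.
move=> j'0 j0; case: _ / (esym j'0) in u *; case: _ / (esym j0) in v *.
by move=> /phi_unit[_ [-> _]]; rewrite mxE.
Qed.

Lemma bid_evec i p q : bmx (bid e (evec i)) p q = e i.
Proof. by rewrite !mxE (evec_row_eq p q) eqxx mulr1n sig1_evec. Qed.

Lemma lunit_natural s m (f : bmat e s m) :
  f ∘ bideq e (otens1l r m) = bideq e (otens1l r s) ∘ (`1 (evec ord0) ⊗ f).
Proof.
have index_l t (p : 'I_`|evec ord0 ** t|_1) E : brow2 (Pi_block p) = cast_ord E p.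
  apply: Pi_block_unit => [l k|l].
    by rewrite [X in (_ %/ X < _)%N]card_evec [X in (_ < _ %/ X)%N]card_evec !divn1.
  by rewrite /bdim /btype1 sig1_evec zc1l.
apply: bmat_eqP => p q.
rewrite (bmul_bideq _ _ (congr1 (fun m : nvec n => `|m|_1) (otens1l r m))).
rewrite (bideq_bmul _ _ (congr1 (fun m : nvec n => `|m|_1) (esym (otens1l r s)))).
set p' := cast_ord _ p; have [u [v ->]] := btens_entry (`1 (evec ord0)) f p' q.
rewrite bid_evec phi_unit_l; first 1 last.
- exact: sig1_evec.
- exact: sig1_evec.
- exact: bmat_corner.
have q_eq := index_l _ q (congr1 (fun m : nvec n => `|m|_1) (otens1l r m)).
have p_eq := index_l _ p' (congr1 (fun m : nvec n => `|m|_1) (otens1l r s)).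
by rewrite q_eq p_eq cast_ord_comp cast_ord_id.
Qed.

Lemma runit_natural s m (f : bmat e s m) :
  f ∘ bideq e (otens1r r m) = bideq e (otens1r r s) ∘ (f ⊗ `1 (evec ord0)).
Proof.
have index_r t (p : 'I_`|t ** evec ord0|_1) E : brow1 (Pi_block p) = cast_ord E p.
  apply: Pi_block_unit => [l k|l]; last by rewrite /bdim /btype2 sig1_evec zc1r.
  have bound (u : 'I_(`|evec (ord0 : 'I_n.+1)|_1 * `|t|_1)) : (u < `|t|_1)%N.
    by rewrite (leq_trans (ltn_ord u)) // card_evec mul1n.
  by rewrite /= !modn_small.
apply: bmat_eqP => p q.
rewrite (bmul_bideq _ _ (congr1 (fun m : nvec n => `|m|_1) (otens1r r m))).
rewrite (bideq_bmul _ _ (congr1 (fun m : nvec n => `|m|_1) (esym (otens1r r s)))).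
set p' := cast_ord _ p; have [u [v ->]] := btens_entry f (`1 (evec ord0)) p' q.
rewrite bid_evec phi_unit_r; first 1 last.
- exact: sig1_evec.
- exact: sig1_evec.
- exact: bmat_corner.
have q_eq := index_r _ q (congr1 (fun m : nvec n => `|m|_1) (otens1r r m)).
have p_eq := index_r _ p' (congr1 (fun m : nvec n => `|m|_1) (otens1r r s)).
by rewrite q_eq p_eq cast_ord_comp cast_ord_id.
Qed.

End TensorProduct.

(** * The associator, the triangle and the pentagon *)

Section Associator.
Context (R : pzRingType) (n : nat) (r : zplus_basis R n).
Context (F : fieldType) (A : falgType F) (e : idem_system A n).
Implicit Types m s t : nvec n.
Local Notation "m ** s" := (otens r m s) (at level 40, left associativity).
Local Notation "X ∘ Y" := (bmul X Y) (at level 40, left associativity).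
Local Notation "`1 m" := (bid e m) (at level 8, m at level 2, format "`1 m").
Local Notation ee i := (evec i).
Context (phi : A -> A -> MRAI r e) (a : ass_family r e).
Context (phi_map : tensor_alg_map phi) (phi_id : phi1 phi) (phi_unit : phi2 phi).
Context (ass : associator_system phi a).
Local Notation "X ⊗ Y" := (btens phi X Y) (at level 40, left associativity).
Local Notation α := (associator phi a).

Let btensM := btens_comp phi_map phi_id.
Let btens1 := btens_id phi_map phi_id.

Lemma btens_suml s1 m1 s2 m2 (Y : bmat e s2 m2) (I : finType) (X : I -> bmat e s1 m1) :
  (\sum_i X i) ⊗ Y = \sum_i X i ⊗ Y.
Proof. by apply: (sum_of_linear (f := fun X => X ⊗ Y)) => *; exact: btens_linear_l. Qed.

Lemma btens_sumr s1 m1 s2 m2 (X : bmat e s1 m1) (I : finType) (Y : I -> bmat e s2 m2) :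
  X ⊗ (\sum_i Y i) = \sum_i X ⊗ Y i.
Proof. by apply: (sum_of_linear (f := btens phi X)) => *; exact: btens_linear_r. Qed.

Lemma btens_sum_r s1 m1 s2 m2 s3 m3 (I J K : finType)
    (X : I -> bmat e s1 m1) (Y : J -> bmat e s2 m2) (Z : K -> bmat e s3 m3) :
  (\sum_i X i) ⊗ ((\sum_j Y j) ⊗ (\sum_k Z k)) = \sum_i \sum_j \sum_k X i ⊗ (Y j ⊗ Z k).
Proof.
rewrite btens_suml; apply: eq_bigr => i _; rewrite btens_suml btens_sumr.
by apply: eq_bigr => j _; rewrite !btens_sumr.
Qed.

Lemma btens_sum_l s1 m1 s2 m2 s3 m3 (I J K : finType)
    (X : I -> bmat e s1 m1) (Y : J -> bmat e s2 m2) (Z : K -> bmat e s3 m3) :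
  ((\sum_i X i) ⊗ (\sum_j Y j)) ⊗ (\sum_k Z k) = \sum_i \sum_j \sum_k (X i ⊗ Y j) ⊗ Z k.
Proof.
rewrite !btens_suml; apply: eq_bigr => i _; rewrite [X i ⊗ _]btens_sumr btens_suml.
by apply: eq_bigr => j _; rewrite !btens_sumr.
Qed.

Lemma btens_sum_l4 s1 m1 s2 m2 s3 m3 s4 m4 (I J K L : finType)
    (X : I -> bmat e s1 m1) (Y : J -> bmat e s2 m2) (Z : K -> bmat e s3 m3)
    (W : L -> bmat e s4 m4) :
  (((\sum_i X i) ⊗ (\sum_j Y j)) ⊗ (\sum_k Z k)) ⊗ (\sum_l W l)
  = \sum_i \sum_j \sum_k \sum_l ((X i ⊗ Y j) ⊗ Z k) ⊗ W l.
Proof.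
rewrite btens_sum_l btens_suml; apply: eq_bigr => i _.
rewrite btens_suml; apply: eq_bigr => j _.
by rewrite btens_suml; apply: eq_bigr => k _; rewrite btens_sumr.
Qed.

Lemma whisker_l m s t u (X : bmat e s t) (Y : bmat e t u) :
  `1 m ⊗ (X ∘ Y) = (`1 m ⊗ X) ∘ (`1 m ⊗ Y).
Proof. by rewrite -btensM bmul1l. Qed.

Lemma whisker_r m s t u (X : bmat e s t) (Y : bmat e t u) :
  (X ∘ Y) ⊗ `1 m = (X ⊗ `1 m) ∘ (Y ⊗ `1 m).
Proof. by rewrite -btensM bmul1l. Qed.

Lemma bmat_decomposition m s (X : bmat e m s) : X = \sum_i \sum_(k < m i) Xel e k ∘ (Yel e k ∘ X).
Proof.
rewrite -{1}[X]bmul1l -sum_Xel_Yel bmul_suml; apply: eq_bigr => i _.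
by rewrite bmul_suml; apply: eq_bigr => k _; rewrite bmulA.
Qed.

(** The characteristic property of the associator.  Writing [f], [g] and [h] as
    sums of [Xel k ∘ (Yel k ∘ f)] puts morphisms between basic objects next to
    the [a i j l], where the naturality axiom of the family applies. *)
Lemma associator_basis m s t i j l
    (f : bmat e m (ee i)) (g : bmat e s (ee j)) (h : bmat e t (ee l)) :
  α m s t ∘ ((f ⊗ g) ⊗ h) = (f ⊗ (g ⊗ h)) ∘ a i j l.
Proof.
rewrite [in RHS](bmat_decomposition f) [in RHS](bmat_decomposition g) [in RHS](bmat_decomposition h).
rewrite btens_sum_r /associator !bmul_suml; apply: eq_bigr => i' _.
rewrite !bmul_suml; apply: eq_bigr => j' _.
rewrite !bmul_suml; apply: eq_bigr => l' _.
rewrite btens_sum_r !bmul_suml; apply: eq_bigr => k1 _.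
rewrite !bmul_suml; apply: eq_bigr => k2 _.
rewrite !bmul_suml; apply: eq_bigr => k3 _.
rewrite -[in LHS]bmulA -!btensM -[in LHS]bmulA -(ass_natural ass) bmulA.
by rewrite -!btensM.
Qed.

Lemma associator_ee i j l : α (ee i) (ee j) (ee l) = a i j l.
Proof.
have := associator_basis (`1 (ee i)) (`1 (ee j)) (`1 (ee l)).
by rewrite !btens1 bmul1l bmul1r.
Qed.

Lemma btens3_Xel_ext m s t u (f g : bmat e u ((m ** s) ** t)) :
  (forall i j l (k1 : 'I_(m i)) (k2 : 'I_(s j)) (k3 : 'I_(t l)),
     f ∘ ((Xel e k1 ⊗ Xel e k2) ⊗ Xel e k3) = g ∘ ((Xel e k1 ⊗ Xel e k2) ⊗ Xel e k3)) ->
  f = g.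
Proof.
move=> fg; rewrite -[f]bmul1r -[g]bmul1r -!btens1 -!sum_Xel_Yel.
rewrite btens_sum_l !bmul_sumr; apply: eq_bigr => i _.
rewrite !bmul_sumr; apply: eq_bigr => j _.
rewrite !bmul_sumr; apply: eq_bigr => l _.
rewrite btens_sum_l !bmul_sumr; apply: eq_bigr => k1 _.
rewrite !bmul_sumr; apply: eq_bigr => k2 _.
rewrite !bmul_sumr; apply: eq_bigr => k3 _.
by rewrite !btensM !bmulA fg.
Qed.

Lemma associator_natural m s t m' s' t'
    (f : bmat e m' m) (g : bmat e s' s) (h : bmat e t' t) :
  (f ⊗ (g ⊗ h)) ∘ α m s t = α m' s' t' ∘ ((f ⊗ g) ⊗ h).
Proof.
apply: btens3_Xel_ext => i j l k1 k2 k3.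
by rewrite -!bmulA associator_basis bmulA -!btensM associator_basis.
Qed.

(** The inverse has the same shape as the associator, with [a i j l] replaced by
    its inverse and the two bracketings exchanged. *)
Lemma associator_isom m s t :
  exists b : bmat e ((m ** s) ** t) (m ** (s ** t)),
    b ∘ α m s t = `1 _ /\ α m s t ∘ b = `1 _.
Proof.
have ex_l i j := fin_all_exists (ass_invertible ass i j).
have ex_jl i := fin_all_exists (ex_l i).
have [b bP] := fin_all_exists ex_jl.
pose β := \sum_i \sum_j \sum_l \sum_(k1 < m i) \sum_(k2 < s j) \sum_(k3 < t l)
  ((Xel e k1 ⊗ Xel e k2) ⊗ Xel e k3) ∘ b i j l ∘ (Yel e k1 ⊗ (Yel e k2 ⊗ Yel e k3)).
exists β; split.
  rewrite -!btens1 -!sum_Xel_Yel btens_sum_l.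
  rewrite bmul_suml; apply: eq_bigr => i _.
  rewrite bmul_suml; apply: eq_bigr => j _.
  rewrite bmul_suml; apply: eq_bigr => l _.
  rewrite btens_sum_l bmul_suml; apply: eq_bigr => k1 _.
  rewrite bmul_suml; apply: eq_bigr => k2 _.
  rewrite bmul_suml; apply: eq_bigr => k3 _.
  rewrite -bmulA associator_natural associator_ee !bmulA -[_ ∘ b _ _ _ ∘ a _ _ _]bmulA.
  by rewrite (bP i j l).1 bmul1r -!btensM.
rewrite -!btens1 -!sum_Xel_Yel btens_sum_r.
rewrite bmul_sumr; apply: eq_bigr => i _.
rewrite bmul_sumr; apply: eq_bigr => j _.
rewrite bmul_sumr; apply: eq_bigr => l _.
rewrite btens_sum_r bmul_sumr; apply: eq_bigr => k1 _.
rewrite bmul_sumr; apply: eq_bigr => k2 _.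
rewrite bmul_sumr; apply: eq_bigr => k3 _.
rewrite !bmulA associator_basis -[_ ∘ a _ _ _ ∘ b _ _ _]bmulA.
by rewrite (bP i j l).2 bmul1r -!btensM.
Qed.

(** Variant for the triangle, whose middle object is already basic and has to be
    left alone. *)
Lemma btens3_Xel_unit_ext m s t u (f g : bmat e u ((m ** s) ** t)) :
  (forall i l (k1 : 'I_(m i)) (k3 : 'I_(t l)),
     f ∘ ((Xel e k1 ⊗ `1 s) ⊗ Xel e k3) = g ∘ ((Xel e k1 ⊗ `1 s) ⊗ Xel e k3)) ->
  f = g.
Proof.
move=> fg; apply: btens3_Xel_ext => i j l k1 k2 k3.
rewrite -[Xel e k1]bmul1r -[Xel e k2]bmul1l -[Xel e k3]bmul1r !btensM !bmulA.
by rewrite fg.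
Qed.

Lemma btens_bideq_r m s t (st : s = t) (E : m ** s = m ** t) :
  `1 m ⊗ bideq e st = bideq e E.
Proof. by case: _ / st in E *; rewrite bideq_refl btens1 (eq_irrelevance E erefl). Qed.

Lemma btens_bideq_l m s t (st : s = t) (E : s ** m = t ** m) :
  bideq e st ⊗ `1 m = bideq e E.
Proof. by case: _ / st in E *; rewrite bideq_refl btens1 (eq_irrelevance E erefl). Qed.

Lemma associator_triangle m s :
  (`1 m ⊗ bideq e (otens1l r s)) ∘ α m (ee ord0) s = bideq e (otens1r r m) ⊗ `1 s.
Proof.
apply: btens3_Xel_unit_ext => i j k1 k2.
rewrite -!bmulA associator_basis bmulA -!btensM bmul1l bmul1l.
rewrite -(lunit_natural phi_unit) -(runit_natural phi_unit).
rewrite -[in LHS](bmul1r (Xel e k1)) -[in RHS](bmul1r (Xel e k2)) !btensM.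
rewrite -[LHS]bmulA; congr (_ ∘ _).
(* all three sides become identities between names of the same object *)
rewrite (ass_unit ass) (btens_bideq_r _ (congr1 (otens r (ee i)) (otens1l r (ee j)))).
rewrite (btens_bideq_l _ (congr1 ((otens r)^~ (ee j)) (otens1r r (ee i)))).
exact: bideq_trans.
Qed.

(** Decomposing one argument of the associator, the others being basic, gives
    the sums occurring in the pentagon axiom of the family; there the argument
    is [evec j ** evec k]. *)
Lemma associator_sum_mid i m j :
  α (ee i) m (ee j) = \sum_l \sum_(k < m l)
    (`1 (ee i) ⊗ (Xel e k ⊗ `1 (ee j))) ∘ a i l j ∘ ((`1 (ee i) ⊗ Yel e k) ⊗ `1 (ee j)).
Proof.
rewrite -[LHS]bmul1r -!btens1 -(sum_Xel_Yel e m).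
rewrite btens_sumr btens_suml bmul_sumr; apply: eq_bigr => l _.
rewrite btens_sumr btens_suml bmul_sumr; apply: eq_bigr => k _.
by rewrite -associator_basis -bmulA -!btensM !bmul1l.
Qed.

Lemma associator_sum_left m i j :
  α m (ee i) (ee j) = \sum_l \sum_(k < m l)
    (Xel e k ⊗ `1 (ee i ** ee j)) ∘ a l i j ∘ ((Yel e k ⊗ `1 (ee i)) ⊗ `1 (ee j)).
Proof.
rewrite -[LHS]bmul1r -!btens1 -(sum_Xel_Yel e m).
rewrite !btens_suml bmul_sumr; apply: eq_bigr => l _.
rewrite !btens_suml bmul_sumr; apply: eq_bigr => k _.
by rewrite -associator_basis -bmulA -!btensM !bmul1l.
Qed.

Lemma associator_sum_right i j m :
  α (ee i) (ee j) m = \sum_l \sum_(k < m l)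
    (`1 (ee i) ⊗ (`1 (ee j) ⊗ Xel e k)) ∘ a i j l ∘ (`1 (ee i ** ee j) ⊗ Yel e k).
Proof.
rewrite -[LHS]bmul1r -!btens1 -(sum_Xel_Yel e m).
rewrite btens_sumr bmul_sumr; apply: eq_bigr => l _.
rewrite btens_sumr bmul_sumr; apply: eq_bigr => k _.
by rewrite -associator_basis -bmulA -!btensM !bmul1l.
Qed.

Definition pentagon_at m s t u :=
  (`1 m ⊗ α s t u) ∘ (α m (s ** t) u ∘ (α m s t ⊗ `1 u))
    = α m s (t ** u) ∘ α (m ** s) t u.

Lemma pentagon_basis i1 i2 i3 i4 : pentagon_at (ee i1) (ee i2) (ee i3) (ee i4).
Proof.
rewrite /pentagon_at !associator_ee associator_sum_mid.
rewrite associator_sum_left associator_sum_right bmul_sum.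
transitivity (\sum_j \sum_(k < (ee i2 ** ee i3) j)
  (`1 (ee i1) ⊗ (a i2 i3 i4 ∘ (Xel e k ⊗ `1 (ee i4)))) ∘ a i1 j i4
  ∘ (((`1 (ee i1) ⊗ Yel e k) ∘ a i1 i2 i3) ⊗ `1 (ee i4))).
  rewrite bmul_suml bmul_sumr; apply: eq_bigr => j _.
  rewrite bmul_suml bmul_sumr; apply: eq_bigr => k _.
  by rewrite whisker_l whisker_r !bmulA.
rewrite (ass_pentagon ass); apply: eq_bigr => j _; apply: eq_bigr => j' _.
rewrite bmul_sum; apply: eq_bigr => k _; apply: eq_bigr => k' _.
rewrite !bmulA; congr (_ ∘ _ ∘ _); rewrite -!bmulA; congr (_ ∘ (_ ∘ _)).
by rewrite -btensM bmul1l bmul1r.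
Qed.

(** Both sides of the pentagon are composites of associators, so a tensor product
    [((w ⊗ x) ⊗ y) ⊗ z] of morphisms out of basic objects slides through them
    and comes out as [w ⊗ (x ⊗ (y ⊗ z))] after the pentagon of basic objects. *)
Lemma associator_pentagon m s t u : pentagon_at m s t u.
Proof.
have pentagon_slide i j k l (w : bmat e m (ee i)) (x : bmat e s (ee j))
    (y : bmat e t (ee k)) (z : bmat e u (ee l)) :
    (`1 m ⊗ α s t u) ∘ (α m (s ** t) u ∘ (α m s t ⊗ `1 u)) ∘ (((w ⊗ x) ⊗ y) ⊗ z)
    = α m s (t ** u) ∘ α (m ** s) t u ∘ (((w ⊗ x) ⊗ y) ⊗ z).
  have slide_r : (α m s t ⊗ `1 u) ∘ (((w ⊗ x) ⊗ y) ⊗ z)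
      = ((w ⊗ (x ⊗ y)) ⊗ z) ∘ (α (ee i) (ee j) (ee k) ⊗ `1 (ee l)).
    by rewrite -!btensM bmul1l bmul1r associator_natural.
  have slide_l : (`1 m ⊗ α s t u) ∘ (w ⊗ ((x ⊗ y) ⊗ z))
      = (w ⊗ (x ⊗ (y ⊗ z))) ∘ (`1 (ee i) ⊗ α (ee j) (ee k) (ee l)).
    by rewrite -!btensM bmul1l bmul1r associator_natural.
  rewrite -!bmulA slide_r !bmulA -[_ ∘ α _ _ _ ∘ _]bmulA -associator_natural.
  rewrite bmulA slide_l -!bmulA pentagon_basis.
  by rewrite bmulA associator_natural -bmulA associator_natural !bmulA.
rewrite /pentagon_at; set f := (X in X = _); set g := (X in _ = X).
rewrite -[f]bmul1r -[g]bmul1r -!btens1 -!sum_Xel_Yel.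
rewrite btens_sum_l4 !bmul_sumr; apply: eq_bigr => i _.
rewrite !bmul_sumr; apply: eq_bigr => j _.
rewrite !bmul_sumr; apply: eq_bigr => k _.
rewrite !bmul_sumr; apply: eq_bigr => l _.
rewrite btens_sum_l4 !bmul_sumr; apply: eq_bigr => k1 _.
rewrite !bmul_sumr; apply: eq_bigr => k2 _.
rewrite !bmul_sumr; apply: eq_bigr => k3 _.
rewrite !bmul_sumr; apply: eq_bigr => k4 _.
by rewrite !btensM !bmulA pentagon_slide.
Qed.

End Associator.

Theorem theorem3p12 (F : closedFieldType) (n : nat)
  (R : pzRingType) (r : zplus_basis R n)
  (A : falgType F) (e : idem_system A n)
  (phi : A -> A -> MRAI r e) (a : ass_family r e) :
  admissible_datum phi a -> tensor_category (Chat phi a).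
Proof.
case=> _ _ _ phi_map phi_id phi_unit ass; split=> /=.
- by move=> *; apply: bmulA.
- by move=> *; apply: bmul1l.
- by move=> *; apply: bmul1r.
- by move=> *; apply: bmul_linear_l.
- by move=> *; apply: bmul_linear_r.
- by move=> *; apply: btens_id.
- by move=> *; apply: btens_comp.
- by move=> *; apply: btens_linear_l.
- by move=> *; apply: btens_linear_r.
- by move=> *; apply: associator_natural.
- by move=> *; apply: associator_isom.
- by move=> *; apply: lunit_natural.
- by move=> m; apply: bideq_isom.
- by move=> *; apply: runit_natural.
- by move=> m; apply: bideq_isom.
- by move=> *; apply: associator_pentagon.
- by move=> *; apply: associator_triangle.
Qed.
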